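(* There is an algorithm running in $O(n^2)$ time that, given a permutation $\pi$ of $\{1,\dots,n\}$, outputs a sequence of monotone block moves transforming $\pi$ into the identity permutation whose length is at most $3\operatorname{bc}(\pi)$.
   Context: A block move $(i,j,k)$ with $1\le i\le j<k\le n$ maps $[\dots\pi_{i-1}\,\pi_i\dots\pi_j\,\pi_{j+1}\dots\pi_k\,\pi_{k+1}\dots]$ to $[\dots\pi_{i-1}\,\pi_{j+1}\dots\pi_k\,\pi_i\dots\pi_j\,\pi_{k+1}\dots]$; it is monotone if $\pi_q>\pi_r$ for all $i\le q\le j<r\le k$ (equivalently, no pair of elements changes its relative order more than once over a sequence of such moves). $\operatorname{bc}(\pi)$ denotes the minimum number of monotone block moves needed to sort $\pi$. (This is the problem of monotone block crossing minimization on a single edge.) *)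

(* Defs.v *)
(* Mathematical Components, with boolp for the classical minimum in bc. *)
From mathcomp Require Import all_boot all_fingroup.
From mathcomp Require Import boolp.

Set Implicit Arguments.
Unset Strict Implicit.
Unset Printing Implicit Defensive.


(* The list [pi_1; ...; pi_n] of values in {1, ..., n}: the library's 'S_n
   permutes {0, ..., n-1}, so values are shifted by one. *)
Definition oneline (n : nat) (pi : 'S_n) : seq nat :=
  [seq (pi i).+1 | i <- enum 'I_n].

(* Positions are counted from 1, as in the triples (i, j, k) below. *)
Definition entry (s : seq nat) (q : nat) : nat := nth 0 s q.-1.

Definition move : Type := (nat * nat * nat)%type.

Definition is_block_move (m : move) (n : nat) : Prop :=
  let: (i, j, k) := m in [/\ 1 <= i, i <= j, j < k & k <= n].

Definition block_move (m : move) (s : seq nat) : seq nat :=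
  let: (i, j, k) := m in
  take i.-1 s ++ drop j (take k s) ++ drop i.-1 (take j s) ++ drop k s.

Definition monotone (m : move) (s : seq nat) : Prop :=
  let: (i, j, k) := m in
  forall q r, i <= q <= j -> j < r <= k -> entry s q > entry s r.

Fixpoint transforms (ms : seq move) (s s' : seq nat) : Prop :=
  if ms is m :: ms' then
    [/\ is_block_move m (size s), monotone m s
      & transforms ms' (block_move m s) s']
  else s = s'.

Definition sorts (n : nat) (ms : seq move) (pi : 'S_n) : Prop :=
  transforms ms (oneline pi) (oneline (1%g : 'S_n)).

Lemma oneline1 n : oneline (1%g : 'S_n) = iota 1 n.
Proof.
rewrite /oneline -[1]addn0 iotaDl -val_enum_ord -map_comp.
by apply: eq_map => i /=; rewrite perm1 add1n.
Qed.

Lemma oneline_perm n (pi : 'S_n) : perm_eq (oneline pi) (iota 1 n).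
Proof.
rewrite -oneline1 /oneline; apply: uniq_perm.
- by rewrite map_inj_uniq ?enum_uniq// => i j [] /val_inj /perm_inj.
- by rewrite map_inj_uniq ?enum_uniq// => i j [] /val_inj /perm_inj.
move=> x; apply/mapP/mapP => -[i _ ->].
  by exists (pi i); rewrite ?mem_enum ?perm1.
by exists ((pi^-1)%g i); rewrite ?mem_enum ?permKV ?perm1.
Qed.

Lemma transforms_ex b a t : perm_eq t (iota a.+1 b) ->
  exists ms, transforms ms (iota 1 a ++ t) (iota 1 (a + b)).
Proof.
elim: b a t => [|b IHb] a t tP.
  by exists [::]; rewrite (perm_small_eq _ tP)//= cats0 addn0.
have tU : uniq t by rewrite (perm_uniq tP) iota_uniq.
have t_gt x : x \in t -> a < x by rewrite (perm_mem tP) mem_iota => /andP[].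
have : a.+1 \in t by rewrite (perm_mem tP) mem_iota leqnn addnS ltnS leq_addr.
move=> at_; case/splitPr: at_ tP tU t_gt => t1 t2 tP tU t_gt.
have tP' : perm_eq (t1 ++ t2) (iota a.+2 b).
  by rewrite -(perm_cons a.+1) -[X in perm_eq _ X]/(iota a.+1 b.+1) -(permPr tP)
             perm_sym perm_catC /= perm_cons perm_catC.
have [ms msP] := IHb a.+1 _ tP'.
have iE : iota 1 a.+1 = rcons (iota 1 a) a.+1.
  by rewrite -cats1 -[[:: a.+1]]/(iota (1 + a) 1) -iotaD addn1.
rewrite iE cat_rcons addSnnS in msP.
case: (posnP (size t1)) => [/size0nil t10|t1_gt0].
  by exists ms; move: msP; rewrite t10.
exists ((a.+1, a + size t1, (a + size t1).+1) :: ms) => /=.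
have sa : size (iota 1 a) = a by rewrite size_iota.
split.
- split=> //; first by rewrite -addn1 leq_add2l.
  by rewrite !size_cat /= size_iota addnA -addn1 leq_add2l.
- move=> q r /andP[aq qt] /andP[rt1 rt2].
  have -> : r = (a + size t1).+1 by apply/eqP; rewrite eqn_leq rt2.
  have -> : entry (iota 1 a ++ t1 ++ a.+1 :: t2) (a + size t1).+1 = a.+1.
    rewrite /entry /= nth_cat sa [a + _ < a]ltnNge leq_addr addKn /=.
    by rewrite nth_cat ltnn subnn.
  rewrite /entry !nth_cat sa.
  case: q aq qt => // q; rewrite ltnS /= => aq qt.
  rewrite [q < a]ltnNge aq /=.
  have qs : q - a < size t1 by rewrite ltn_subLR.
  rewrite qs; set x := nth _ _ _.
  have xt : x \in t1 by rewrite mem_nth.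
  have := t_gt x; rewrite mem_cat xt => /(_ isT) ax.
  rewrite ltn_neqAle ax andbT; apply/eqP => xE.
  move: tU; rewrite cat_uniq => /and3P[_ /hasPn/(_ a.+1)].
  by rewrite mem_head xE /= xt => /(_ isT).
suff -> : take a (iota 1 a ++ t1 ++ a.+1 :: t2) ++
   drop (a + size t1) (take (a + size t1).+1 (iota 1 a ++ t1 ++ a.+1 :: t2)) ++
   drop a (take (a + size t1) (iota 1 a ++ t1 ++ a.+1 :: t2)) ++
   drop (a + size t1).+1 (iota 1 a ++ t1 ++ a.+1 :: t2)
   = iota 1 a ++ a.+1 :: t1 ++ t2 by [].
have E1 : iota 1 a ++ t1 ++ a.+1 :: t2 = (iota 1 a ++ t1) ++ a.+1 :: t2.
  by rewrite catA.
have s1 : size (iota 1 a ++ t1) = a + size t1 by rewrite size_cat sa.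
have E2 : iota 1 a ++ t1 ++ a.+1 :: t2 = ((iota 1 a ++ t1) ++ [:: a.+1]) ++ t2.
  by rewrite -!catA.
have s2 : size ((iota 1 a ++ t1) ++ [:: a.+1]) = (a + size t1).+1.
  by rewrite size_cat s1 addn1.
by rewrite take_size_cat // E2 take_size_cat // drop_size_cat // -E2 E1
           take_size_cat // drop_size_cat // -E1 E2 drop_size_cat.
Qed.

Lemma sorts_ex n (pi : 'S_n) :
  exists l, `[< exists2 ms, sorts ms pi & size ms = l >].
Proof.
have [ms msP] := @transforms_ex n 0 _ (oneline_perm pi).
by exists (size ms); apply/asboolP; exists ms; rewrite // /sorts oneline1.
Qed.

Definition bc (n : nat) (pi : 'S_n) : nat := ex_minn (sorts_ex pi).


(* A unit-cost random-access machine with a write-only output tape. Since a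
   single step raises the largest stored number by at most one (beyond the
   constants of the program), a run of t steps only handles numbers of
   O(log (n + t)) bits, so that charging one unit per instruction is sound. *)
Inductive instr : Type :=
| IConst of nat & nat
| ICopy of nat & nat
| IIncr of nat
| IDecr of nat
| ILoad of nat & nat
| IStore of nat & nat
| IJumpLt of nat & nat & nat
| IJumpEq of nat & nat & nat
| IWrite of nat.

Definition program : Type := seq instr.

Record config : Type := Config {
  pc : nat;
  regs : nat -> nat;
  cells : nat -> nat;
  tape : seq nat }.

Definition upd (f : nat -> nat) (x v : nat) : nat -> nat :=
  fun y => if y == x then v else f y.

Definition exec (ins : instr) (c : config) : config :=
  let: Config p R M o := c in
  match ins with
  | IConst d x => Config p.+1 (upd R d x) M o
  | ICopy d a => Config p.+1 (upd R d (R a)) M o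
  | IIncr d => Config p.+1 (upd R d (R d).+1) M o
  | IDecr d => Config p.+1 (upd R d (R d).-1) M o
  | ILoad d a => Config p.+1 (upd R d (M (R a))) M o
  | IStore a b => Config p.+1 R (upd M (R a) (R b)) o
  | IJumpLt a b l => Config (if R a < R b then l else p.+1) R M o
  | IJumpEq a b l => Config (if R a == R b then l else p.+1) R M o
  | IWrite a => Config p.+1 R M (rcons o (R a))
  end.

Definition halted (P : program) (c : config) : bool := size P <= pc c.

Definition step (P : program) (c : config) : config :=
  if onth P (pc c) is Some ins then exec ins c else c.

(* Register 0 holds the length of the input s and cells 1, ..., size s of the
   memory hold its entries; everything else is 0. *)
Definition start (s : seq nat) : config :=
  Config 0 (upd (fun=> 0) 0 (size s)) (nth 0 (0 :: s)) [::].

Definition computes_within (P : program) (s o : seq nat) (t : nat) : Prop :=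
  exists2 t', t' <= t &
    let c := iter t' (step P) (start s) in halted P c /\ tape c = o.

Definition encode_moves (ms : seq move) : seq nat :=
  flatten [seq [:: m.1.1; m.1.2; m.2] | m <- ms].

Definition is_bigO (f g : nat -> nat) : Prop :=
  exists C n0, forall n, n0 <= n -> f n <= C * g n.

(* Main.v *)
(* Call an adjacent pair (x, y) of the list 0, pi_1, ..., pi_n, n + 1 a break if
   y <> x + 1. A block move alters three adjacent pairs, so it removes at most
   three breaks, and the identity has none: pi has at most 3 bc(pi) breaks.
   Conversely, if 1, ..., i - 1 are in place and i is not, exchange the maximal
   run i, i + 1, ... of consecutive values with everything between i - 1 and it.
   The three pairs that are cut are breaks, and the pair (i - 1, i) is created,
   so every move removes a break. Locating and moving the run takes O(n) steps
   for each i. *)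
Require Import Defs.
From mathcomp Require Import all_boot all_fingroup.
From mathcomp Require Import boolp zify.

Set Implicit Arguments.
Unset Strict Implicit.
Unset Printing Implicit Defensive.

(** * Breaks and the lower bound on [bc] *)

Fixpoint breaks (x : nat) (s : seq nat) : nat :=
  if s is y :: s' then (y != x.+1) + breaks y s' else 0.

Lemma breaks_cat x s t : breaks x (s ++ t) = breaks x s + breaks (last x s) t.
Proof. by elim: s x => //= y s IHs x; rewrite IHs addnA. Qed.

Lemma breaks_iota a b : breaks a (iota a.+1 b) = 0.
Proof. by elim: b a => //= b IHb a; rewrite eqxx IHb. Qed.

Lemma last_iota a b : last a (iota a.+1 b) = a + b.
Proof. by elim: b a => [|b IHb] a /=; rewrite ?addn0// IHb addSnnS. Qed.

Lemma breaks_start x y s : breaks x s <= (breaks y s).+1.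
Proof.
by case: s => //= z s; lia.
Qed.

Lemma last_nonempty (T : Type) (x y : T) s : 0 < size s -> last x s = last y s.
Proof. by case: s. Qed.

(** Pairs inside a block survive, so only the pairs ending in the first entries of [A], [B] and [C]
    can change. A nonempty block has a last entry independent of what precedes it. *)
Lemma breaks_swap x A B C : 0 < size A -> 0 < size B ->
  breaks x (A ++ B ++ C) <= breaks x (B ++ A ++ C) + 3.
Proof.
move=> A0 B0; rewrite !breaks_cat.
rewrite (last_nonempty (last x A) x B0) (last_nonempty (last x B) x A0).
have := breaks_start x (last x B) A; have := breaks_start (last x A) x B.
have := breaks_start (last x B) (last x A) C; lia.
Qed.

Lemma block_move_split (i j k : nat) (s : seq nat) :
  is_block_move (i, j, k) (size s) ->
  exists X A B C, [/\ s = X ++ A ++ B ++ C, block_move (i, j, k) s = X ++ B ++ A ++ C,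
    0 < size A & 0 < size B].
Proof.
case=> i1 ij jk ks; exists (take i.-1 s), (drop i.-1 (take j s)), (drop j (take k s)), (drop k s).
have E1 : take i.-1 s = take i.-1 (take j s) by rewrite take_takel //; lia.
have E2 : take j s = take j (take k s) by rewrite take_takel //; lia.
split=> //; rewrite ?size_drop ?size_takel //; try lia.
by rewrite catA E1 cat_take_drop E2 catA cat_take_drop cat_take_drop.
Qed.

(** The suffix [c] makes room for the closing entry [n + 1], which no move touches. *)
Lemma breaks_transforms ms s s' c : transforms ms s s' ->
  breaks 0 (s ++ c) <= breaks 0 (s' ++ c) + 3 * size ms.
Proof.
elim: ms s => [|[[i j] k] ms IHms] s /=; first by move=> ->; rewrite addn0.
case=> bm _ /IHms {IHms}.
have [X [A [B [C [-> /= -> A0 B0]]]]] := block_move_split bm.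
move=> le; rewrite -!catA !(breaks_cat 0 X) in le *.
have := breaks_swap (last 0 X) (C ++ c) A0 B0; lia.
Qed.

Definition num_breaks (s : seq nat) : nat := breaks 0 (rcons s (size s).+1).

Lemma num_breaks_bc n (pi : 'S_n) : num_breaks (oneline pi) <= 3 * bc pi.
Proof.
rewrite /bc; case: ex_minnP => l /asboolP[ms msP <-] _.
have /(breaks_transforms [:: n.+1]) := msP; rewrite oneline1.
have sE : size (oneline pi) = n by rewrite size_map size_enum_ord.
rewrite /num_breaks sE -cats1 => /leq_trans-> //.
by rewrite breaks_cat breaks_iota last_iota /= eqxx.
Qed.

(** * The greedy move *)

(** An exhausted [C] reads as the default [0], which differs from [x + b.+1]; cell [n + 1] of the
    memory ends a run in the same way. *)
Lemma maximal_run x (D : seq nat) :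
  exists b C, x :: D = iota x b.+1 ++ C /\ nth 0 C 0 != x + b.+1.
Proof.
elim: D x => [|y D IHD] x; first by exists 0, [::]; split => //=; rewrite addn1.
case: (eqVneq y x.+1) => [->|yx]; last by exists 0, (y :: D); split => //=; rewrite addn1.
by have [b [C [-> CP]]] := IHD x.+1; exists b.+1, C; split; rewrite // addnS.
Qed.

Section Greedy.

Variables (a b : nat) (A C : seq nat).
Let B := iota a.+1 b.+1.
Let s := iota 1 a ++ A ++ B ++ C.
Let s' := iota 1 a ++ B ++ A ++ C.
Let m : move := (a.+1, a + size A, a + size A + b.+1).

Lemma greedy_block_move : block_move m s = s'.
Proof.
rewrite /block_move /m /= -/B.
have E0 : size (iota 1 a) = a by rewrite size_iota.
have E1 : s = (iota 1 a ++ A) ++ B ++ C by rewrite /s catA.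
have E2 : s = (iota 1 a ++ A ++ B) ++ C by rewrite /s -!catA.
have s1 : size (iota 1 a ++ A) = a + size A by rewrite size_cat E0.
have s2 : size (iota 1 a ++ A ++ B) = a + size A + b.+1.
  by rewrite !size_cat E0 size_iota addnA.
have -> : take (a + size A + b.+1) s = (iota 1 a ++ A) ++ B.
  by rewrite E2 take_size_cat // catA.
have -> : take (a + size A) s = iota 1 a ++ A by rewrite E1 take_size_cat.
have -> : drop (a + size A + b.+1) s = C by rewrite E2 drop_size_cat.
by rewrite take_size_cat // !drop_size_cat.
Qed.

(** The leading [0] makes indices agree with memory cells. The two middle cases are what the
    program's fill loop and shift loop write. *)
Lemma greedy_nth j : nth 0 (0 :: s') j =
  if j < a.+1 then nth 0 (0 :: s) j else
  if j < a.+1 + b.+1 then j else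
  if j <= a + size A + b.+1 then nth 0 (0 :: s) (j - b.+1) else nth 0 (0 :: s) j.
Proof.
have sB : size B = b.+1 by rewrite size_iota.
have nB i : i < b.+1 -> nth 0 B i = a.+1 + i by move=> ib; rewrite nth_iota.
rewrite /s /s'; move: sB nB; generalize B => B' sB nB.
case: j => //= j; rewrite ltnS.
have [ja|ja] := ltnP j a; first by rewrite !nth_cat size_iota ja.
rewrite nth_cat size_iota ltnNge ja /= nth_cat sB.
have -> : (j.+1 < a.+1 + b.+1) = (j - a < b.+1) by lia.
have [jb|jb] := ltnP (j - a) b.+1; first by rewrite nB //; lia.
rewrite nth_cat; have -> : (j < a + size A + b.+1) = (j - a - b.+1 < size A) by lia.
have [jA|jA] := ltnP (j - a - b.+1) (size A).
  rewrite subSn; last by lia.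
  rewrite /= nth_cat size_iota ifN; last by lia.
  by rewrite nth_cat ifT; [congr nth|]; lia.
rewrite nth_cat size_iota ifN; last by lia.
rewrite nth_cat ifN; last by lia.
by rewrite nth_cat sB ifN; [congr nth|]; lia.
Qed.

Lemma greedy_nth_skipped e : e < size A -> nth 0 (0 :: s) (a.+1 + e) = nth 0 A e.
Proof.
move=> eA; rewrite addSn -[LHS]/(nth 0 s (a + e)) /s nth_cat size_iota.
by rewrite ifN ?addKn ?nth_cat ?eA //; lia.
Qed.

Lemma greedy_nth_run e : nth 0 (0 :: s) (a.+1 + size A + e) = nth 0 (B ++ C) e.
Proof.
rewrite !addSn -[LHS]/(nth 0 s (a + size A + e)) /s nth_cat size_iota ifN; last by lia.
by rewrite nth_cat ifN; [congr nth|]; lia.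
Qed.

Hypothesis sP : perm_eq s (iota 1 (size s)).
Hypothesis A_gt0 : 0 < size A.
Hypothesis runP : nth 0 C 0 != a.+1 + b.+1.

(** The values up to [a + b.+1] are used up by the sorted prefix and the run, and [s] has no
    repetition. *)
Lemma greedy_gt x : x \in A -> a + b.+1 < x.
Proof.
move=> xA.
have sU : uniq s by rewrite (perm_uniq sP) iota_uniq.
have : x \in s by rewrite !mem_cat xA orbT.
rewrite (perm_mem sP) mem_iota => /andP[x1 _].
move: sU; rewrite !cat_uniq => /and3P[_ /hasPn h1 /and3P[_ /hasPn h2 _]].
have : x \notin iota 1 a by apply: h1; rewrite mem_cat xA.
have : x \notin B by apply/negP => xB; have := h2 x; rewrite mem_cat xB xA => /(_ isT).
rewrite !mem_iota; lia.
Qed.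

Lemma greedy_is_block_move : is_block_move m (size s).
Proof. rewrite /s !size_cat !size_iota; split; lia. Qed.

Lemma greedy_monotone : monotone m s.
Proof.
move=> q r /andP[q1 q2] /andP[r1 r2].
have qA : entry s q \in A.
  rewrite /entry nth_cat size_iota ifN; last by lia.
  have qs : q.-1 - a < size A by lia.
  by rewrite nth_cat qs mem_nth.
have : entry s r \in B.
  rewrite /entry nth_cat size_iota ifN; last by lia.
  rewrite nth_cat ifN; last by lia.
  have rs : r.-1 - a - size A < size B by rewrite size_iota; lia.
  by rewrite nth_cat rs mem_nth.
by have := greedy_gt qA; rewrite mem_iota; lia.
Qed.

(** All three seams of [s] are breaks, whereas in [s'] the seam from [a] to [a.+1] is not, so at
    most two remain. *)
Lemma greedy_num_breaks : num_breaks s' < num_breaks s.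
Proof.
rewrite /num_breaks -!cats1.
have -> : size s' = size s by rewrite !size_cat !size_iota; lia.
set z := (size s).+1; rewrite /s /s' -!catA !(breaks_cat 0 (iota 1 a)) last_iota add0n.
rewrite ltn_add2l (breaks_cat _ A) !(breaks_cat _ B) breaks_iota last_iota breaks_cat.
have [h [A' AE]] : exists h A', A = h :: A' by case: A A_gt0 => // h A' _; exists h, A'.
have hA : h != a.+1.
  by have := @greedy_gt h; rewrite AE mem_head => /(_ isT); lia.
have lA x : last x A \in A by rewrite AE /= mem_last.
have BE x : x \in A -> breaks x B = 1.
  move=> /greedy_gt xA; rewrite /B /= breaks_iota addn0.
  by have -> : a.+1 != x.+1 by lia.
(* If [C] is empty, [g] is the closing entry, and it exceeds [(a + b.+1).+1] because [A] is
   nonempty. *)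
have [g [D [CE gP]]] : exists g D, C ++ [:: z] = g :: D /\ g != (a + b.+1).+1.
  case: C runP => [|g D] /= gP; [exists z, [::] | exists g, (D ++ [:: z])]; split=> //.
  by rewrite /z /s !size_cat !size_iota; lia.
rewrite (BE (last a A)) //.
have -> : last (last a A) B = a + b.+1 by rewrite /B /= -addSnnS -last_iota.
rewrite CE AE /= hA gP.
by case: (h != _); case: (g != _); lia.
Qed.

End Greedy.

(** * The program and its loops *)

(* Registers: 0 holds n, 1 holds i; 2 and 3 are the two ends k and m of the run,
   reused as source and destination when the entries before the run are
   shifted; 4 holds the last entry read and 5 the next value of the run.
   The run loop needs no bounds check, since cell n + 1 holds 0. *)
Definition greedy_program : program := [::
  (*  0 *) IConst 1 1;
  (*  1 *) IJumpLt 0 1 31;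
  (*  2 *) ICopy 2 1;
  (*  3 *) ILoad 4 2;
  (*  4 *) IJumpEq 4 1 7;
  (*  5 *) IIncr 2;
  (*  6 *) IJumpEq 0 0 3;
  (*  7 *) IJumpEq 2 1 29;
  (*  8 *) ICopy 3 2;
  (*  9 *) ICopy 5 1;
  (* 10 *) IIncr 3;
  (* 11 *) IIncr 5;
  (* 12 *) ILoad 4 3;
  (* 13 *) IJumpEq 4 5 10;
  (* 14 *) IDecr 3;
  (* 15 *) IDecr 2;
  (* 16 *) IWrite 1;
  (* 17 *) IWrite 2;
  (* 18 *) IWrite 3;
  (* 19 *) IJumpLt 2 1 25;
  (* 20 *) ILoad 4 2;
  (* 21 *) IStore 3 4;
  (* 22 *) IDecr 2;
  (* 23 *) IDecr 3;
  (* 24 *) IJumpEq 0 0 19;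
  (* 25 *) IJumpLt 3 1 29;
  (* 26 *) IStore 3 3;
  (* 27 *) IDecr 3;
  (* 28 *) IJumpEq 0 0 25;
  (* 29 *) IIncr 1;
  (* 30 *) IJumpEq 0 0 1].

Definition reaches (c : config) (t : nat) (Q : config -> Prop) : Prop :=
  exists2 t', t' <= t & Q (iter t' (step greedy_program) c).

Lemma reaches_now c t (Q : config -> Prop) : Q c -> reaches c t Q.
Proof. by exists 0. Qed.

Lemma reaches_leq c t t' Q : reaches c t Q -> t <= t' -> reaches c t' Q.
Proof. by case=> u ut Qu tt'; exists u => //; apply: leq_trans tt'. Qed.

Lemma reaches_exec ins p R M o t Q : onth greedy_program p = Some ins ->
  reaches (exec ins (Config p R M o)) t Q -> reaches (Config p R M o) t.+1 Q.
Proof.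
by move=> pP [u ut Qu]; exists u.+1; rewrite // iterSr [step _ _]/step /= pP.
Qed.

Arguments upd _ _ _ _ /.

(* The continuations describe the final registers only by the values read later
   and the final memory pointwise, which avoids equations between functions. *)
Lemma search_loop d R M o t Q :
  M (R 2 + d) = R 1 -> (forall e, e < d -> M (R 2 + e) != R 1) ->
  (forall R', R' 0 = R 0 -> R' 1 = R 1 -> R' 2 = R 2 + d ->
     reaches (Config 7 R' M o) t Q) ->
  reaches (Config 3 R M o) (4 * d + 2 + t) Q.
Proof.
elim: d R => [|d IHd] R Md Ne cont.
  rewrite muln0 add0n !addSn add0n.
  do 2!apply: reaches_exec => //=; rewrite -[R 2]addn0 Md eqxx.
  by apply: cont; rewrite ?addn0.
rewrite mulnS !addSn add0n.
do 2!apply: reaches_exec => //=.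
have := Ne 0 isT; rewrite addn0 => /negbTE->.
do 2!apply: reaches_exec => //=; rewrite eqxx.
apply: IHd => /=.
- by rewrite addSnnS.
- by move=> e ed; rewrite addSnnS; apply: Ne.
- by move=> R' R0 R1 R2; apply: cont => //; rewrite R2 addSnnS.
Qed.

(** Here [d] counts the run without its first value. Register 3 stops one cell past the run, which
    the next instruction corrects. *)
Lemma run_loop d R M o t Q :
  (forall e, e < d -> M (R 3 + e).+1 = (R 5 + e).+1) -> M (R 3 + d).+1 != (R 5 + d).+1 ->
  (forall R', R' 0 = R 0 -> R' 1 = R 1 -> R' 2 = R 2 -> R' 3 = (R 3 + d).+1 ->
     reaches (Config 14 R' M o) t Q) ->
  reaches (Config 10 R M o) (4 * d + 4 + t) Q.
Proof.
elim: d R => [|d IHd] R Eq Ne cont.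
  rewrite muln0 add0n !addSn add0n.
  do 4!apply: reaches_exec => //=; rewrite -[R 3]addn0 -[R 5]addn0 (negbTE Ne).
  by apply: cont; rewrite ?addn0.
rewrite mulnS !addSn add0n.
do 4!apply: reaches_exec => //=.
have := Eq 0 isT; rewrite !addn0 => ->; rewrite eqxx.
apply: IHd => /=.
- by move=> e ed; rewrite !addSnnS; apply: Eq.
- by rewrite !addSnnS.
- by move=> R' R0 R1 R2 R3; apply: cont => //; rewrite R3 addSnnS.
Qed.

(** Copying goes from right to left and the destination stays ahead of the source, so each entry is
    read before it is overwritten. The offset [R 3 - R 2], the length of the run, is invariant. *)
Lemma shift_loop d R M o t Q :
  0 < R 1 -> R 2 = (R 1 + d).-1 -> R 2 < R 3 ->
  (forall R' M', R' 0 = R 0 -> R' 1 = R 1 -> R' 3 = R 3 - d ->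
     (forall j, M' j = if R 3 - d < j <= R 3 then M (j - (R 3 - R 2)) else M j) ->
     reaches (Config 25 R' M' o) t Q) ->
  reaches (Config 19 R M o) (6 * d + 1 + t) Q.
Proof.
elim: d R M => [|d IHd] R M R1 R2 R23 cont.
  rewrite muln0 add0n !addSn add0n.
  apply: reaches_exec => //=; have -> : R 2 < R 1 by lia.
  by apply: cont; rewrite ?subn0 // => j; case: ifP => // ?; lia.
rewrite mulnS !addSn add0n.
apply: reaches_exec => //=; have -> : R 2 < R 1 = false by lia.
do 5!apply: reaches_exec => //=; rewrite eqxx.
apply: IHd => //=; try lia.
move=> R' M' R0' R1' R3' M'E; apply: cont => //; first by rewrite R3'; lia.
by move=> j; rewrite M'E; do 4?case: ifP => ?; congr M; lia.
Qed.

(** The run need not be saved: after the move its values equal their positions, so each cell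
    receives its own index. *)
Lemma fill_loop d R M o t Q :
  0 < R 1 -> (R 3).+1 = R 1 + d ->
  (forall R' M', R' 0 = R 0 -> R' 1 = R 1 ->
     (forall j, M' j = if R 1 <= j <= R 3 then j else M j) ->
     reaches (Config 29 R' M' o) t Q) ->
  reaches (Config 25 R M o) (4 * d + 1 + t) Q.
Proof.
elim: d R M => [|d IHd] R M R1 R3 cont.
  rewrite muln0 add0n !addSn add0n.
  apply: reaches_exec => //=; have -> : R 3 < R 1 by lia.
  by apply: cont => // j; case: ifP => // ?; lia.
rewrite mulnS !addSn add0n.
apply: reaches_exec => //=; have -> : R 3 < R 1 = false by lia.
do 3!apply: reaches_exec => //=; rewrite eqxx.
apply: IHd => //=; try lia.
move=> R' M' R0' R1' M'E; apply: cont => // j; rewrite M'E.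
by do 3?case: ifP => ?; lia.
Qed.

(** * Correctness and running time *)

(** Induction on the number [d] of entries behind the sorted prefix, which grows by one per round.
    The list [ms] is chosen before the machine state, so the sorting claim and the output claim
    concern the same moves. *)
Lemma outer_loop d a t (s := iota 1 a ++ t) :
  size t = d -> perm_eq s (iota 1 (size s)) ->
  exists ms, [/\ transforms ms s (iota 1 (size s)), size ms <= num_breaks s
    & forall R M o, R 0 = size s -> R 1 = a.+1 -> M =1 nth 0 (0 :: s) ->
      reaches (Config 1 R M o) (d * (10 * size s + 30) + 1)
        (fun c => halted greedy_program c /\ tape c = o ++ encode_moves ms)].
Proof.
rewrite {}/s; elim: d a t => [|d IHd] a t td sP.
  have sE : size (iota 1 a ++ t) = a by rewrite size_cat size_iota td addn0.
  exists [::]; split => //; first by rewrite sE (size0nil td) /= cats0.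
  move=> R M o R0 R1 _; apply: reaches_exec => //=; rewrite R0 R1 sE leqnn.
  by apply: reaches_now; rewrite cats0.
have sE : size (iota 1 a ++ t) = a + d.+1 by rewrite size_cat size_iota td.
have at_ : a.+1 \in t.
  have : a.+1 \in iota 1 a ++ t by rewrite (perm_mem sP) sE mem_iota; lia.
  by rewrite mem_cat mem_iota; case: (_ \in t); rewrite ?orbF //; lia.
have [A [b [C [tE runP aA]]]] : exists A b C,
    [/\ t = A ++ iota a.+1 b.+1 ++ C, nth 0 C 0 != a.+1 + b.+1 & a.+1 \notin A].
  case/splitPr: at_ sP => A D sP.
  have [b [C [-> CP]]] := maximal_run a.+1 D.
  exists A, b, C; split => //; apply/negP => aA.
  have : uniq (iota 1 a ++ A ++ a.+1 :: D) by rewrite (perm_uniq sP) iota_uniq.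
  rewrite cat_uniq => /and3P[_ _]; rewrite cat_uniq => /and3P[_ /hasPn/(_ a.+1)].
  by rewrite mem_head aA => /(_ isT).
subst t.
set s := iota 1 a ++ _ in sP sE *; set n := size s in sP sE *.
have nE : n = a + size A + b.+1 + size C.
  by rewrite /n /s !size_cat !size_iota !addnA.
have search R M o t Q : R 0 = n -> R 1 = a.+1 -> M =1 nth 0 (0 :: s) ->
    (forall R', R' 0 = n -> R' 1 = a.+1 -> R' 2 = a.+1 + size A ->
      reaches (Config 7 R' M o) t Q) ->
    reaches (Config 1 R M o) (4 * size A + 4 + t) Q.
  move=> R0 R1 ME cont.
  rewrite [4 * _ + 4 + _](_ : _ = (4 * size A + 2 + t).+2); last by lia.
  apply: reaches_exec => //=; rewrite R0 R1 ifN; last by lia.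
  apply: reaches_exec => //=; apply: search_loop => /=; rewrite R1.
  - by rewrite ME -[_ + _]addn0 greedy_nth_run.
  - move=> e eA; rewrite ME greedy_nth_skipped //.
    by apply: contraNneq aA => <-; apply: mem_nth.
  - by move=> R' R0' R1' R2'; apply: cont; rewrite // ?R0' ?R1'.
have next R M o t Q : R 0 = n -> R 1 = a.+1 ->
    (forall R', R' 0 = n -> R' 1 = a.+2 -> reaches (Config 1 R' M o) t Q) ->
    reaches (Config 29 R M o) t.+2 Q.
  move=> R0 R1 cont; do 2!apply: reaches_exec => //=; rewrite eqxx.
  by apply: cont; rewrite //= R1.
(* With [A] empty, [a.+1] is already in place and the round emits no move. *)
have [A0|A_gt0] := posnP (size A).
  have {}A0 := size0nil A0; subst A.
  have s1 : s = iota 1 a.+1 ++ iota a.+2 b ++ C.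
    by rewrite -[a.+1]addn1 iotaD -catA /s add1n addn1.
  have td' : size (iota a.+2 b ++ C) = d by move: td; rewrite /= => -[].
  have := IHd a.+1 _ td'; rewrite -s1 -/n => /(_ sP)[ms [msT msB msR]].
  exists ms; split => // R M o R0 R1 ME.
  apply: (@reaches_leq _ (4 * 0 + 4 + (d * (10 * n + 30) + 1).+3)); last by lia.
  apply: search => // R' R0' R1' R2'.
  apply: reaches_exec => //=; rewrite R1' R2' addn0 eqxx.
  by apply: next => // R'' R0'' R1''; apply: msR.
set s' := iota 1 a ++ iota a.+1 b.+1 ++ A ++ C.
have s'1 : s' = iota 1 a.+1 ++ iota a.+2 b ++ A ++ C.
  by rewrite -[a.+1]addn1 iotaD -catA /s' add1n addn1.
have s's : perm_eq s' s by rewrite perm_cat2l perm_catCA.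
have ns' : size s' = n := perm_size s's.
have td' : size (iota a.+2 b ++ A ++ C) = d.
  by move: td; rewrite !size_cat !size_iota; lia.
have := IHd a.+1 _ td'; rewrite -s'1 ns' (perm_trans s's sP) => /(_ isT)[ms [msT msB msR]].
pose m : move := (a.+1, a + size A, a + size A + b.+1).
exists (m :: ms); split.
- split; [exact: greedy_is_block_move | exact: greedy_monotone | by rewrite greedy_block_move].
- by apply: leq_ltn_trans msB _; apply: greedy_num_breaks.
move=> R M o R0 R1 ME.
(* A skipped entry costs 4 steps in the search and 6 in the shift, a run entry 4 in each of its two
   loops; hence at most [10 * n + 30] per round. *)
pose u := 4 * size A + 4 + (3 + (4 * b + 4 + (5 + (6 * size A + 1 + (4 * b.+1 + 1 +
  (d * (10 * n + 30) + 1).+2))))).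
apply: (@reaches_leq _ u); last by rewrite /u; lia.
apply: search => // R' R0' R1' R2' {R R0 R1}.
apply: reaches_exec => //=; rewrite R1' R2' ifN; last by lia.
do 2!apply: reaches_exec => //=; apply: run_loop => /=; rewrite R1' R2'.
- move=> e eb; rewrite ME -addnS greedy_nth_run -addnS.
  by rewrite nth_cat size_iota ltnS eb nth_iota.
- by rewrite ME -!addnS greedy_nth_run nth_cat size_iota ltnn subnn.
move=> R; rewrite R0' => {R' R0' R1' R2'} R0 R1 R2 R3.
do 5!apply: reaches_exec => //=.
apply: shift_loop; rewrite /= ?R1 ?R2 ?R3; try lia.
move=> R' M' /=; rewrite R0 => R0' R1' R3' M'E.
apply: fill_loop => //; try by lia.
move=> R'' M'' R0'' R1'' M''E.
apply: next => [||S S0 S1]; rewrite ?R0'' ?R1'' ?R0' ?R1' //.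
have -> : a.+1 + size A + b = m.2 by rewrite /m /= !addSn addnS.
have -> : encode_moves (m :: ms) = [:: m.1.1; m.1.2; m.2] ++ encode_moves ms by [].
rewrite catA -!cats1 -(catA _ [:: _] [:: _]) -catA.
apply: msR => // j; rewrite M''E R1' R3' M'E /s' greedy_nth -/s -!ME.
by do 5?case: ifP => ?; try lia; congr M; lia.
Qed.

Theorem theorem2 :
  exists (P : program) (T : nat -> nat),
    is_bigO T (fun n : nat => n ^ 2) /\
    forall (n : nat) (pi : 'S_n), exists ms : seq move,
      [/\ computes_within P (oneline pi) (encode_moves ms) (T n),
          sorts ms pi
        & size ms <= 3 * bc pi].
Proof.
exists greedy_program, (fun n => n * (10 * n + 30) + 2); split.
  (* For [n >= 1], each of the three terms is at most its coefficient times [n ^ 2], and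
     [10 + 30 + 2 = 42]. *)
  by exists 42, 1 => n n1; nia.
move=> n pi; have piP := oneline_perm pi.
have sE : size (oneline pi) = n by rewrite (perm_size piP) size_iota.
have := @outer_loop n 0 (oneline pi) sE; rewrite /= sE => /(_ piP)[ms [msT msB msR]].
exists ms; split; last exact: leq_trans msB (num_breaks_bc pi).
- suff: reaches (start (oneline pi)) (n * (10 * n + 30) + 1).+1
      (fun c => halted greedy_program c /\ tape c = encode_moves ms) by rewrite -addnS.
  by apply: reaches_exec => //=; apply: msR; rewrite ?sE.
- by rewrite /sorts oneline1.
Qed.
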